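(* Let $C=\begin{pmatrix}p&q&0\\ q&p&0\\ 0&0&r\end{pmatrix}$ with $p,q,r\in\mathbb{R}$, $p>|q|$ and $r>0$. Then $F\in\mathrm{GL}^+(3)$ with $F^TF=C$ is uniquely determined, up to an arbitrary $Q\in\mathrm{SO}(3)$, by $$F=Q\begin{pmatrix}a&0&0\\0&b&0\\0&0&c\end{pmatrix}\begin{pmatrix}1&\gamma&0\\0&1&0\\0&0&1\end{pmatrix},$$ where $$a=\sqrt p,\qquad b=\sqrt{\frac{p^2-q^2}{p}},\qquad c=\sqrt r,\qquad\gamma=\frac qp;$$ that is, $F\in\mathrm{GL}^+(3)$ satisfies $F^TF=C$ if and only if $F$ has this form for some $Q\in\mathrm{SO}(3)$. In terms of the singular values $\lambda_1,\lambda_2,\lambda_3>0$ of $F$, labelled such that $\lambda_1^2=p+q$, $\lambda_2^2=p-q$, $\lambda_3^2=r$, $$a=\sqrt{\frac{\lambda_1^2+\lambda_2^2}{2}},\qquad b=\lambda_1\lambda_2\sqrt{\frac{2}{\lambda_1^2+\lambda_2^2}},\qquad c=\lambda_3,\qquad\gamma=\frac{\lambda_1^2-\lambda_2^2}{\lambda_1^2+\lambda_2^2}.$$ In particular, if $\hat T$ is an isotropic Biot stress response such that $\hat T(C')=0$ if and only if $C'=\mathbb{1}$, and if $F\in\mathrm{GL}^+(3)$ satisfies $\hat T(F^TF)=s\,(e_1\otimes e_2+e_2\otimes e_1)$ for some $s\in\mathbb{R}$, then $F$ is necessarily of the form $$F=Q\begin{pmatrix}a&0&0\\0&b&0\\0&0&c\end{pmatrix}\begin{pmatrix}1&\gamma&0\\0&1&0\\0&0&1\end{pmatrix}$$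 with $a=\sqrt p$, $b=\sqrt{\frac{p^2-q^2}{p}}$, $c=\sqrt r$, $\gamma=\frac qp$ for some $p,q,r\in\mathbb{R}$ with $p>|q|$, $r>0$, and some $Q\in\mathrm{SO}(3)$.
   Context: $\mathrm{GL}^+(3)$ denotes the real $3\times3$ matrices with positive determinant, $\mathrm{Sym}(3)$ the symmetric real $3\times 3$ matrices, $\mathrm{Sym}^+(3)$ the positive definite symmetric ones, and $\mathbb{1}$ the identity matrix. An isotropic Biot stress response is a map $\hat T:\mathrm{Sym}^+(3)\to\mathrm{Sym}(3)$ with $\hat T(QCQ^T)=Q\hat T(C)Q^T$ for all $Q\in\mathrm{SO}(3)$ and $C\in\mathrm{Sym}^+(3)$; the Biot stress corresponding to a deformation gradient $F\in\mathrm{GL}^+(3)$ is $\hat T(F^TF)$. Here $s\,(e_1\otimes e_2+e_2\otimes e_1)=\begin{pmatrix}0&s&0\\ s&0&0\\ 0&0&0\end{pmatrix}$. *)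

(* Defs.v *)
From HB Require Import structures.
From mathcomp Require Import all_boot all_order all_algebra.
From mathcomp Require Import reals.

Set Implicit Arguments.
Unset Strict Implicit.
Unset Printing Implicit Defensive.

Import Order.TTheory GRing.Theory Num.Theory.

Local Open Scope ring_scope.

Section MatrixSets.
Variables (R : realType) (n : nat).
Implicit Types F C Q : 'M[R]_n.

Definition GLpos F : Prop := 0 < \det F.

Definition SOn Q : Prop := Q^T *m Q = 1%:M /\ \det Q = 1.

Definition Sympos C : Prop :=
  C \is symmetricmx /\
  forall v : 'cV[R]_n, v != 0 -> 0 < (v^T *m C *m v) ord0 ord0.

(* The listing [s] is unordered and has multiplicities: the squares of its
   entries are the roots of the characteristic polynomial of F^T F. *)
Definition singular_values F (s : seq R) : Prop :=
  {in s, forall l, 0 <= l} /\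
  char_poly (F^T *m F) = \prod_(l <- s) ('X - (l ^+ 2)%:P).

End MatrixSets.

(* A map Sym^+(3) -> Sym(3) is represented by a total function on matrices,
   constrained only on Sym^+(3); its values elsewhere are irrelevant. *)
Definition isotropic_Biot_response (R : realType)
    (T : 'M[R]_3 -> 'M[R]_3) : Prop :=
  (forall C, Sympos C -> T C \is symmetricmx) /\
  (forall Q C, SOn Q -> Sympos C -> T (Q *m C *m Q^T) = Q *m T C *m Q^T).

Definition mat3 (R : realType)
    (x11 x12 x13 x21 x22 x23 x31 x32 x33 : R) : 'M[R]_3 :=
  \matrix_(i < 3, j < 3)
    nth 0 (nth [::] [:: [:: x11; x12; x13];
                        [:: x21; x22; x23];
                        [:: x31; x32; x33]] i) j.

(* Main.v *)
Require Import Defs.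
From HB Require Import structures.
From mathcomp Require Import all_boot all_order all_algebra.
From mathcomp Require Import reals.
From mathcomp Require Import sesquilinear spectral complex ring lra.

Set Implicit Arguments.
Unset Strict Implicit.
Unset Printing Implicit Defensive.

Import Order.TTheory GRing.Theory Num.Theory.

Local Open Scope ring_scope.

(** Isotropy forces T(C) to commute with C: if v is an eigenvector of C, the
    half-turn about v is a rotation that fixes C under conjugation, hence also
    fixes T(C), so that v is an eigenvector of T(C); and the eigenvectors of C
    span.  A symmetric matrix commuting with s (e1 (x) e2 + e2 (x) e1), s <> 0,
    has the entries p, q, q, p, r, while s = 0 forces C = 1.  The triangular
    matrix U = diag(a, b, c) (1 + gamma e1 (x) e2) satisfies U^T U = C, and any
    other F with F^T F = C and positive determinant differs from it by the
    rotation F U^-1. *)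

(** * Real symmetric matrices and their eigenvectors *)

Lemma symmetricmx_trP (R : fieldType) n (A : 'M[R]_n) :
  reflect (A^T = A) (A \is symmetricmx).
Proof.
by apply: (iffP (is_hermitianmxP _ _ _)); rewrite expr0 scale1r map_mx_id.
Qed.

(* Over R[i] the spectral theorem gives a unitary matrix whose rows are
   eigenvectors for real eigenvalues, so their real and imaginary parts are real
   eigenvectors. *)
Lemma real_symmetric_eigenvectors_annihilator (R : rcfType) (n m : nat)
    (A : 'M[R]_n) (M : 'M[R]_(n, m)) :
  A \is symmetricmx ->
  (forall (v : 'rV[R]_n) a, v *m A = a *: v -> v *m M = 0) -> M = 0.
Proof.
move=> symA AM.
pose toC k l (B : 'M[R]_(k, l)) : 'M[R[i]]_(k, l) := map_mx (real_complex R) B.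
pose reM k l (B : 'M[R[i]]_(k, l)) := map_mx (@complex.Re R) B.
pose imM k l (B : 'M[R[i]]_(k, l)) := map_mx (@complex.Im R) B.
(* The factor [D] is real, so multiplication by it acts separately on real and imaginary parts. *)
have ReImM k l j (B : 'M[R[i]]_(k, l)) (D : 'M[R]_(l, j)) :
    (reM _ _ (B *m toC _ _ D) = reM _ _ B *m D) *
    (imM _ _ (B *m toC _ _ D) = imM _ _ B *m D).
  split; apply/matrixP => x y; rewrite !mxE raddf_sum; apply: eq_bigr => z _;
    by rewrite !mxE; case: (B x z) => u w /=; ring.
have hermA : toC _ _ A \is hermsymmx.
  apply: realsym_hermsym.
    by apply/symmetricmx_trP; rewrite /toC matrix.map_trmx (symmetricmx_trP _ symA).
  by apply/mxOverP => i j; rewrite mxE; apply/Creal_ImP; rewrite -complexIm.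
have := hermitian_spectral_diag_real hermA.
have /orthomx_spectralP := hermitian_normalmx hermA.
have := spectral_unit (toC _ _ A).
set P := spectralmx _; set d := spectral_diag _ => uP defA reald.
have PA : P *m toC _ _ A = diag_mx d *m P by rewrite defA !mulmxA mulmxV // mul1mx.
(* As [P] is invertible, it suffices that each of its rows annihilates [M]. *)
suff PM : P *m toC _ _ M = 0.
  have: toC _ _ M = 0 by rewrite -[LHS](mulKmx uP) PM mulmx0.
  by move/matrixP=> M0; apply/matrixP=> i j; have := M0 i j; rewrite !mxE => -[].
apply/row_matrixP => i; rewrite row_mul row0.
have [a da] : exists a : R, d 0 i = a%:C%C.
  exists (complex.Re (d 0 i)); apply/eqP; rewrite eq_complex /= eqxx /=.
  by have /mxOverP/(_ 0 i)/Creal_ImP := reald; rewrite -complexIm => -[->].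
have rowPA : row i P *m toC _ _ A = a%:C%C *: row i P.
  by rewrite -row_mul PA row_mul row_diag_mx -scalemxAl -rowE da.
have Re0 : reM _ _ (row i P) *m M = 0.
  apply: (AM _ a); rewrite -(ReImM _ _ _ _ _).1 rowPA.
  by apply/rowP => j; rewrite !mxE; case: (P i j) => u w /=; ring.
have Im0 : imM _ _ (row i P) *m M = 0.
  apply: (AM _ a); rewrite -(ReImM _ _ _ _ _).2 rowPA.
  by apply/rowP => j; rewrite !mxE; case: (P i j) => u w /=; ring.
apply/rowP => j; apply/eqP; rewrite eq_complex.
have := Re0; rewrite -(ReImM _ _ _ _ _).1 => /rowP/(_ j); rewrite 2!mxE => ->.
have := Im0; rewrite -(ReImM _ _ _ _ _).2 => /rowP/(_ j); rewrite 2!mxE => ->.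
by rewrite !mxE /= eqxx.
Qed.

(** * Entrywise computations, mostly with 3 by 3 matrices *)

Lemma det_mx33 (S : comNzRingType) (A : 'M[S]_3) :
  let a (i j : nat) := A (inord i) (inord j) in
  \det A = a 0%N 0%N * (a 1%N 1%N * a 2%N 2%N - a 1%N 2%N * a 2%N 1%N)
         - a 0%N 1%N * (a 1%N 0%N * a 2%N 2%N - a 1%N 2%N * a 2%N 0%N)
         + a 0%N 2%N * (a 1%N 0%N * a 2%N 1%N - a 1%N 1%N * a 2%N 0%N).
Proof.
move=> a.
have aE (i j : 'I_3) : A i j = a i j by rewrite /a !inord_val.
rewrite (expand_det_row _ ord0) !big_ord_recl big_ord0 /cofactor.
rewrite 3!(expand_det_row _ ord0) !big_ord_recl !big_ord0 /cofactor.
rewrite !det_mx11 !mxE !aE /= /bump /=.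
ring.
Qed.

Lemma inord_eq n (i j : nat) :
  (i <= n)%N -> (j <= n)%N -> (inord i == inord j :> 'I_n.+1) = (i == j).
Proof. by move=> i_le j_le; rewrite -val_eqE /= !inordK. Qed.

Lemma mulmx_tr_self_gt0 (R : realDomainType) n (v : 'rV[R]_n) :
  v != 0 -> 0 < (v *m v^T) 0 0.
Proof.
move=> v0; have sq i : 0 <= v 0 i * v^T i 0 by rewrite mxE -expr2 sqr_ge0.
rewrite mxE lt0r sumr_ge0 // andbT psumr_eq0 //; apply: contra v0 => /allP v0.
apply/eqP/rowP => i; apply/eqP; have := v0 i; rewrite mem_index_enum => /(_ isT).
by rewrite !mxE mulf_eq0 orbb.
Qed.

Section Mat3.
Variable R : realType.

Lemma mat3_eta (A : 'M[R]_3) :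
  exists x11 x12 x13 x21 x22 x23 x31 x32 x33,
    A = mat3 x11 x12 x13 x21 x22 x23 x31 x32 x33.
Proof.
pose a (i j : nat) := A (inord i) (inord j).
exists (a 0%N 0%N), (a 0%N 1%N), (a 0%N 2%N), (a 1%N 0%N), (a 1%N 1%N), (a 1%N 2%N).
exists (a 2%N 0%N), (a 2%N 1%N), (a 2%N 2%N).
apply/matrixP => i j; rewrite mxE -[in LHS](inord_val i) -[in LHS](inord_val j).
by case: i j => [[|[|[|i]]] //= Hi] [[|[|[|j]]] //= Hj].
Qed.

Lemma mat3_inj (x11 x12 x13 x21 x22 x23 x31 x32 x33
    y11 y12 y13 y21 y22 y23 y31 y32 y33 : R) :
  mat3 x11 x12 x13 x21 x22 x23 x31 x32 x33 =
  mat3 y11 y12 y13 y21 y22 y23 y31 y32 y33 ->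
  [/\ x11 = y11, x12 = y12 & x13 = y13] /\
  [/\ x21 = y21, x22 = y22 & x23 = y23] /\
  [/\ x31 = y31, x32 = y32 & x33 = y33].
Proof.
move/matrixP => E.
have e (i j : nat) (Hi : (i < 3)%N) (Hj : (j < 3)%N) := E (Ordinal Hi) (Ordinal Hj).
do 3?split; [move: (e 0%N 0%N isT isT)|move: (e 0%N 1%N isT isT)|move: (e 0%N 2%N isT isT)
  |move: (e 1%N 0%N isT isT)|move: (e 1%N 1%N isT isT)|move: (e 1%N 2%N isT isT)
  |move: (e 2%N 0%N isT isT)|move: (e 2%N 1%N isT isT)|move: (e 2%N 2%N isT isT)];
  by rewrite !mxE.
Qed.

Lemma mulmx_mat3 (x11 x12 x13 x21 x22 x23 x31 x32 x33
    y11 y12 y13 y21 y22 y23 y31 y32 y33 : R) :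
  mat3 x11 x12 x13 x21 x22 x23 x31 x32 x33 *m
  mat3 y11 y12 y13 y21 y22 y23 y31 y32 y33 =
  mat3 (x11 * y11 + x12 * y21 + x13 * y31) (x11 * y12 + x12 * y22 + x13 * y32)
         (x11 * y13 + x12 * y23 + x13 * y33)
       (x21 * y11 + x22 * y21 + x23 * y31) (x21 * y12 + x22 * y22 + x23 * y32)
         (x21 * y13 + x22 * y23 + x23 * y33)
       (x31 * y11 + x32 * y21 + x33 * y31) (x31 * y12 + x32 * y22 + x33 * y32)
         (x31 * y13 + x32 * y23 + x33 * y33).
Proof.
apply/matrixP => i j; rewrite !mxE !big_ord_recl big_ord0 !mxE.
by case: i j => [[|[|[|i]]] //= Hi] [[|[|[|j]]] //= Hj]; rewrite addr0 addrA.
Qed.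

Lemma trmx_mat3 (x11 x12 x13 x21 x22 x23 x31 x32 x33 : R) :
  (mat3 x11 x12 x13 x21 x22 x23 x31 x32 x33)^T =
  mat3 x11 x21 x31 x12 x22 x32 x13 x23 x33.
Proof.
apply/matrixP => i j; rewrite !mxE.
by case: i j => [[|[|[|i]]] //= Hi] [[|[|[|j]]] //= Hj].
Qed.

Lemma scalar_mat3 (a : R) : a%:M = mat3 a 0 0 0 a 0 0 0 a.
Proof.
apply/matrixP => i j; rewrite !mxE.
by case: i j => [[|[|[|i]]] //= Hi] [[|[|[|j]]] //= Hj].
Qed.

Lemma det_mat3 (x11 x12 x13 x21 x22 x23 x31 x32 x33 : R) :
  \det (mat3 x11 x12 x13 x21 x22 x23 x31 x32 x33) =
  x11 * (x22 * x33 - x23 * x32) - x12 * (x21 * x33 - x23 * x31)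
  + x13 * (x21 * x32 - x22 * x31).
Proof. by rewrite det_mx33 !mxE !inordK. Qed.

(** The eigenvectors (1, 1, 0), (1, -1, 0) and e3 have eigenvalues p + q, p - q and r; for a Gram
    matrix F^T F these are the squared singular values of F. *)
Lemma char_poly_mat3 (p q r : R) :
  char_poly (mat3 p q 0 q p 0 0 0 r) =
  ('X - (p + q)%:P) * ('X - (p - q)%:P) * ('X - r%:P).
Proof.
rewrite /char_poly det_mx33 !mxE !inordK // !inord_eq //=.
rewrite ?polyCD ?polyCN ?polyC0; ring.
Qed.
End Mat3.

(** The quadratic form at v is |F v|^2, and F is injective. *)
Lemma GLpos_gram_Sympos (R : realType) n (F : 'M[R]_n) :
  GLpos F -> Sympos (F^T *m F).
Proof.
move=> detF; split; first by apply/symmetricmx_trP; rewrite trmx_mul trmxK.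
move=> v v0; have uF : F \in unitmx by rewrite unitmxE unitfE gt_eqF.
have Fv0 : (F *m v)^T != 0.
  by apply: contra v0; rewrite trmx_eq0 => /eqP Fv0; rewrite -(mulKmx uF v) Fv0 mulmx0.
by have := mulmx_tr_self_gt0 Fv0; rewrite trmxK trmx_mul !mulmxA.
Qed.

(** * Half-turns, and the consequences of isotropy *)

Section HalfTurn.
Variable R : realType.
Implicit Types (v : 'rV[R]_3) (C : 'M[R]_3).

(** Twice the orthogonal projection onto the line of the row vector v, minus the identity: it fixes
    v and negates the plane orthogonal to v. At v = 0 it degenerates to -1, which is not a
    rotation. *)
Definition halfturn v : 'M[R]_3 :=
  (2 / (v *m v^T) 0 0) *: (v^T *m v) - 1%:M.

Lemma trmx_halfturn v : (halfturn v)^T = halfturn v.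
Proof. by rewrite /halfturn linearB linearZ /= trmx_mul trmxK trmx1. Qed.

Lemma halfturn_SOn v : v != 0 -> SOn (halfturn v).
Proof.
move=> /mulmx_tr_self_gt0 k0; split.
  rewrite trmx_halfturn /halfturn; set k := (v *m v^T) 0 0 in k0 *.
  (* v^T v is k times a projection, so the square of 2/k v^T v - 1 collapses to 1. *)
  have PP : v^T *m v *m (v^T *m v) = k *: (v^T *m v).
    by rewrite mulmxA -(mulmxA _ v) [v *m v^T]mx11_scalar mul_mx_scalar scalemxAl.
  rewrite mulmxBl !mulmxBr -!scalemxAl -!scalemxAr PP !mulmx1 !mul1mx !scalerA.
  rewrite [_ * k](_ : _ = 2 / k + 2 / k) ?scalerDl; last by field; rewrite gt_eqF.
  by rewrite addrK opprB addrCA subrr addr0.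
have kE : (v *m v^T) 0 0 =
    v 0 (inord 0) ^+ 2 + v 0 (inord 1) ^+ 2 + v 0 (inord 2) ^+ 2.
  rewrite mxE !big_ord_recl big_ord0 !mxE addr0 addrA -!expr2.
  by congr (v 0 _ ^+ 2 + v 0 _ ^+ 2 + v 0 _ ^+ 2); apply/val_inj; rewrite /= inordK.
rewrite /halfturn; set k := (v *m v^T) 0 0 in k0 kE *.
have tk : 2 / k * k = 2 by rewrite divfK ?gt_eqF.
rewrite det_mx33 !mxE !big_ord1 !mxE !inord_eq //=.
move: tk; rewrite {2}kE; set t := 2 / k.
move: (v 0 (inord 0)) (v 0 (inord 1)) (v 0 (inord 2)) => x y z tk.
(* In dimension three, det (t v^T v - 1) = t |v|^2 - 1, and t |v|^2 = 2. *)
by transitivity (t * (x ^+ 2 + y ^+ 2 + z ^+ 2) - 1); [ring|rewrite tk; ring].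
Qed.

(** Symmetry of C makes v^T a column eigenvector for the same a, so both products of C with v^T v
    equal a v^T v. *)
Lemma halfturn_comm v C a :
  C \is symmetricmx -> v *m C = a *: v -> halfturn v *m C = C *m halfturn v.
Proof.
move=> /symmetricmx_trP symC vC.
have Cv : C *m v^T = a *: v^T by rewrite -{1}symC -trmx_mul vC linearZ.
rewrite /halfturn mulmxBl mulmxBr mul1mx mulmx1 -scalemxAl -scalemxAr.
by rewrite -mulmxA vC mulmxA Cv -scalemxAl -scalemxAr.
Qed.

Lemma isotropic_eigenvector T C v a :
  isotropic_Biot_response T -> Sympos C -> v *m C = a *: v ->
  exists b, v *m T C = b *: v.
Proof.
move=> [_ isoT] posC vC.
have [->|v0] := eqVneq v 0; first by exists 0; rewrite mul0mx scaler0.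
have [QQ detQ] := halfturn_SOn v0.
have QC := halfturn_comm posC.1 vC.
have TC := isoT _ _ (conj QQ detQ) posC.
have k0 := mulmx_tr_self_gt0 v0.
rewrite trmx_halfturn in QQ TC.
(* The half-turn H fixes C under conjugation, so isotropy becomes T C = H (T C) H. *)
rewrite QC -mulmxA QQ mulmx1 in TC.
have {TC} : T C *m halfturn v = halfturn v *m T C.
  by rewrite {1}TC -mulmxA QQ mulmx1.
rewrite /halfturn mulmxBl mulmxBr mul1mx mulmx1 -scalemxAl -scalemxAr.
move/addIr/(scalerI _); rewrite mulf_neq0 ?invr_eq0 ?pnatr_eq0 ?gt_eqF // => /(_ isT).
move/(congr1 (mulmx v)); rewrite !mulmxA => TP.
(* T C now commutes with v^T v; multiplying by v on the left gives (v T C v^T) v = |v|^2 v T C, so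
   the eigenvalue is the Rayleigh quotient. *)
exists ((v *m T C *m v^T) 0 0 / (v *m v^T) 0 0).
apply: (scalerI (a := (v *m v^T) 0 0)); first by rewrite gt_eqF.
rewrite scalerA mulrC divfK ?gt_eqF // -!mul_scalar_mx -!mx11_scalar.
by rewrite TP mulmxA.
Qed.

Lemma isotropic_comm T C :
  isotropic_Biot_response T -> Sympos C -> T C *m C = C *m T C.
Proof.
move=> isoT posC; apply/eqP; rewrite -subr_eq0; apply/eqP.
(* A common eigenvector of C and T C annihilates their commutator. *)
apply: (real_symmetric_eigenvectors_annihilator posC.1) => v a vC.
have [b vT] := isotropic_eigenvector isoT posC vC.
by rewrite mulmxBr !mulmxA vC vT -!scalemxAl vC vT !scalerA mulrC subrr.
Qed.

End HalfTurn.

(** * The triangular factor of C and its parameters *)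

Section ShearForm.
Variable R : realType.
Variables p q r : R.
Hypotheses (qp : `|q| < p) (r0 : 0 < r).

Let D : 'M[R]_3 :=
  mat3 (Num.sqrt p) 0 0 0 (Num.sqrt ((p ^+ 2 - q ^+ 2) / p)) 0 0 0 (Num.sqrt r).
Let G : 'M[R]_3 := mat3 1 (q / p) 0 0 1 0 0 0 1.
Let U := D *m G.

Let p0 : 0 < p. Proof. exact: le_lt_trans qp. Qed.

Let pq0 : 0 < p ^+ 2 - q ^+ 2.
Proof.
by rewrite subr_gt0 -[q ^+ 2]real_normK ?num_real // ltr_pXn2r ?nnegrE // ltW.
Qed.

(** U is the Cholesky factor: a^2 = p, a^2 gamma = q, and b^2 = p - q^2 / p is the Schur complement
    of the first entry, whence a^2 gamma^2 + b^2 = p. *)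
Lemma shear_form_gram : U^T *m U = mat3 p q 0 q p 0 0 0 r.
Proof.
have := sqr_sqrtr (ltW p0); have := sqr_sqrtr (ltW r0).
have := sqr_sqrtr (ltW (divr_gt0 pq0 p0)).
rewrite /U /D /G; set a : R := Num.sqrt p; set b : R := Num.sqrt (_ / _).
set c : R := Num.sqrt r; move=> bE cE aE.
have pn0 : p != 0 by rewrite gt_eqF.
rewrite !mulmx_mat3 trmx_mat3 mulmx_mat3; congr (mat3 _ _ _ _ _ _ _ _ _); try ring.
- by rewrite -aE; ring.
- by transitivity (a ^+ 2 * (q / p)); [ring|rewrite aE; field].
- by transitivity (a ^+ 2 * (q / p)); [ring|rewrite aE; field].
- transitivity (a ^+ 2 * (q / p) ^+ 2 + b ^+ 2); first ring.
  by rewrite aE bE; field.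
- by rewrite -cE; ring.
Qed.

Lemma det_shear_form_gt0 : GLpos U.
Proof.
rewrite /GLpos /U det_mulmx !det_mat3 ?(mul0r, mulr0, subr0, addr0, mulr1).
by rewrite !mulr_gt0 ?sqrtr_gt0 ?divr_gt0.
Qed.

Lemma shear_formP F :
  (GLpos F /\ F^T *m F = mat3 p q 0 q p 0 0 0 r) <->
  (exists Q : 'M[R]_3, SOn Q /\ F = Q *m D *m G).
Proof.
have U0 := det_shear_form_gt0.
have uU : U \in unitmx by rewrite unitmxE unitfE gt_eqF.
split=> [[F0 FC]|[Q [[QQ detQ] ->]]]; last first.
  rewrite -(mulmxA Q) -/U trmx_mul mulmxA -(mulmxA _ Q^T) QQ mulmx1 shear_form_gram.
  by split=> //; rewrite /GLpos det_mulmx detQ mul1r.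
exists (F *m invmx U); rewrite -(mulmxA _ D) -/U mulmxKV //; split=> //.
have QQ : (F *m invmx U)^T *m (F *m invmx U) = 1%:M.
  rewrite trmx_mul mulmxA -(mulmxA _ F^T) FC -shear_form_gram mulmxA.
  by rewrite -trmx_mul mulmxV // trmx1 mul1mx mulmxV.
(* Orthogonality leaves the determinant 1 or -1; positivity of det F and det U excludes -1. *)
split=> //; have := congr1 determinant QQ.
rewrite det_mulmx det_tr det1 -expr2 => /eqP; rewrite sqrf_eq1.
have : 0 < \det (F *m invmx U) by rewrite det_mulmx det_inv mulr_gt0 ?invr_gt0.
by move=> detQ /orP[/eqP //|/eqP detN]; move: detQ; rewrite detN ltr0N1.
Qed.

(** Since |q| < p, the eigenvalues of C are positive and have positive roots; thus the labelling
    used in the parameter formulas always exists. *)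
Lemma shear_form_singular_values F :
  F^T *m F = mat3 p q 0 q p 0 0 0 r ->
  exists l1 l2 l3 : R,
    [/\ 0 < l1, 0 < l2 & 0 < l3] /\
    singular_values F [:: l1; l2; l3] /\
    [/\ l1 ^+ 2 = p + q, l2 ^+ 2 = p - q & l3 ^+ 2 = r].
Proof.
move=> FC; have := qp; rewrite ltr_norml => /andP[qNp q_lt_p].
have pDq : 0 < p + q by lra.
have pBq : 0 < p - q by lra.
exists (Num.sqrt (p + q)), (Num.sqrt (p - q)), (Num.sqrt r).
rewrite !sqrtr_gt0 !sqr_sqrtr ?ltW //; split=> //; split=> //; split.
  by move=> l; rewrite !inE => /or3P[] /eqP->; exact: sqrtr_ge0.
by rewrite FC char_poly_mat3 !big_cons big_nil mulr1 mulrA !sqr_sqrtr ?ltW.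
Qed.

(** Everything follows from l1^2 + l2^2 = 2p, l1^2 - l2^2 = 2q and l1^2 l2^2 = p^2 - q^2; positivity
    of the l's fixes the signs of the roots. *)
Lemma shear_form_parameters (l1 l2 l3 : R) :
  [/\ 0 < l1, 0 < l2 & 0 < l3] ->
  [/\ l1 ^+ 2 = p + q, l2 ^+ 2 = p - q & l3 ^+ 2 = r] ->
  [/\ Num.sqrt p = Num.sqrt ((l1 ^+ 2 + l2 ^+ 2) / 2),
      Num.sqrt ((p ^+ 2 - q ^+ 2) / p) =
        l1 * l2 * Num.sqrt (2 / (l1 ^+ 2 + l2 ^+ 2)),
      Num.sqrt r = l3
    & q / p = (l1 ^+ 2 - l2 ^+ 2) / (l1 ^+ 2 + l2 ^+ 2)].
Proof.
move=> [l1_gt0 l2_gt0 l3_gt0] [l1E l2E l3E].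
have pn0 : p != 0 by rewrite gt_eqF.
have sumE : l1 ^+ 2 + l2 ^+ 2 = 2 * p by rewrite l1E l2E; ring.
split.
- by rewrite sumE mulrC mulKf // pnatr_eq0.
- have -> : (p ^+ 2 - q ^+ 2) / p = (l1 * l2) ^+ 2 * (2 / (l1 ^+ 2 + l2 ^+ 2)).
    by rewrite sumE exprMn l1E l2E; field.
  by rewrite sqrtrM ?sqr_ge0 // sqrtr_sqr gtr0_norm ?mulr_gt0.
- by rewrite -l3E sqrtr_sqr gtr0_norm.
- by rewrite sumE l1E l2E; field.
Qed.

End ShearForm.

(** * From shear stress to the shape of C, and the theorem *)

Lemma comm_shear_stress (R : realType) (C : 'M[R]_3) (s : R) :
  s != 0 -> C \is symmetricmx ->
  mat3 0 s 0 s 0 0 0 0 0 *m C = C *m mat3 0 s 0 s 0 0 0 0 0 ->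
  exists p q r, C = mat3 p q 0 q p 0 0 0 r.
Proof.
move=> s0 /symmetricmx_trP.
have [x11 [x12 [x13 [x21 [x22 [x23 [x31 [x32 [x33 ->]]]]]]]]] := mat3_eta C.
rewrite trmx_mat3 => /mat3_inj[[_ -> ->] [[_ _ ->] _]]; rewrite !mulmx_mat3.
(* These entries of the commutation relation say s x22 = s x11, s x23 = 0 and s x13 = 0. *)
move=> /mat3_inj[[_ E12 E13] [[_ _ E23] _]].
exists x11, x12, x33.
have -> : x22 = x11 by apply: (mulfI s0); lra.
have -> : x13 = 0 by apply: (mulfI s0); lra.
by have -> : x23 = 0 by apply: (mulfI s0); lra.
Qed.

(** At (1, 1, 0), (1, -1, 0) and e3 the quadratic form takes the values 2(p + q), 2(p - q) and r. *)
Lemma Sympos_shear_form (R : realType) (p q r : R) :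
  Sympos (mat3 p q 0 q p 0 0 0 r) -> `|q| < p /\ 0 < r.
Proof.
move=> [_ pos].
pose w (x y z : R) : 'cV[R]_3 := \col_i nth 0 [:: x; y; z] i.
have wE x y z : ((w x y z)^T *m mat3 p q 0 q p 0 0 0 r *m w x y z) ord0 ord0 =
    p * x ^+ 2 + 2 * q * x * y + p * y ^+ 2 + r * z ^+ 2.
  rewrite mxE !big_ord_recl big_ord0 !mxE !big_ord_recl !big_ord0 !mxE /=.
  by ring.
have w0 x y z i : (i < 3)%N -> nth 0 [:: x; y; z] i != 0 -> w x y z != 0.
  move=> i3; apply: contra => /eqP/matrixP/(_ (Ordinal i3) 0).
  by rewrite !mxE => ->.
have := pos _ (w0 1 1 0 0%N isT (oner_neq0 _)).
have := pos _ (w0 1 (-1) 0 0%N isT (oner_neq0 _)).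
have := pos _ (w0 0 0 1 2%N isT (oner_neq0 _)).
rewrite !wE => r_gt0 pBq pDq; split; last by lra.
by rewrite ltr_norml; apply/andP; split; lra.
Qed.

Theorem propositionA1 (R : realType) :
  (forall p q r : R, `|q| < p -> 0 < r ->
     let C := mat3 p q 0
                   q p 0
                   0 0 r in
     let a := Num.sqrt p in
     let b := Num.sqrt ((p ^+ 2 - q ^+ 2) / p) in
     let c := Num.sqrt r in
     let gamma := q / p in
     (forall F : 'M[R]_3,
        (GLpos F /\ F^T *m F = C) <->
        (exists Q : 'M[R]_3, SOn Q /\
           F = Q *m mat3 a 0 0
                         0 b 0
                         0 0 c
                 *m mat3 1 gamma 0
                         0 1     0
                         0 0     1)) /\
     (forall F : 'M[R]_3, GLpos F -> F^T *m F = C ->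
        (exists l1 l2 l3 : R,
           [/\ 0 < l1, 0 < l2 & 0 < l3] /\
           singular_values F [:: l1; l2; l3] /\
           [/\ l1 ^+ 2 = p + q, l2 ^+ 2 = p - q & l3 ^+ 2 = r]) /\
        (forall l1 l2 l3 : R,
           [/\ 0 < l1, 0 < l2 & 0 < l3] ->
           singular_values F [:: l1; l2; l3] ->
           [/\ l1 ^+ 2 = p + q, l2 ^+ 2 = p - q & l3 ^+ 2 = r] ->
           [/\ a = Num.sqrt ((l1 ^+ 2 + l2 ^+ 2) / 2),
               b = l1 * l2 * Num.sqrt (2 / (l1 ^+ 2 + l2 ^+ 2)),
               c = l3
             & gamma = (l1 ^+ 2 - l2 ^+ 2) / (l1 ^+ 2 + l2 ^+ 2)]))) /\
  (forall T : 'M[R]_3 -> 'M[R]_3,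
     isotropic_Biot_response T ->
     (forall C' : 'M[R]_3, Sympos C' -> (T C' = 0 <-> C' = 1%:M)) ->
     forall (F : 'M[R]_3) (s : R), GLpos F ->
       T (F^T *m F) = mat3 0 s 0
                           s 0 0
                           0 0 0 ->
       exists (p q r : R) (Q : 'M[R]_3),
         [/\ `|q| < p, 0 < r, SOn Q &
             F = Q *m mat3 (Num.sqrt p) 0 0
                           0 (Num.sqrt ((p ^+ 2 - q ^+ 2) / p)) 0
                           0 0 (Num.sqrt r)
                   *m mat3 1 (q / p) 0
                           0 1       0
                           0 0       1]).
Proof.
split=> [p q r qp r0 C a b c gamma|T isoT T0 F s F0 TF].
  split=> F; first exact: shear_formP.
  move=> _ FC; split; first exact: shear_form_singular_values.
  by move=> l1 l2 l3 l_gt0 _; exact: shear_form_parameters.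
have posC := GLpos_gram_Sympos F0.
have [p [q [r FC]]] : exists p q r, F^T *m F = mat3 p q 0 q p 0 0 0 r.
  (* For s = 0 commutation carries no information; there the zero stress forces C = 1, that is p = r
     = 1 and q = 0. *)
  have [s0|s0] := eqVneq s 0; last first.
    apply: (comm_shear_stress s0 posC.1).
    by have := isotropic_comm isoT posC; rewrite TF.
  exists 1, 0, 1; rewrite -scalar_mat3; apply/(T0 _ posC).1.
  by rewrite TF s0 -scalar_mat3 raddf0.
have [qp r0] : `|q| < p /\ 0 < r by apply: Sympos_shear_form; rewrite -FC.
have [Q [SOQ FE]] := (shear_formP qp r0 F).1 (conj F0 FC).
by exists p, q, r, Q; split.
Qed.
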